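(* Let $\mathbb{A}$ be a finite nonempty alphabet. Assume that either $y \in\mathbb{A}^{\mathbb{Z}}$, or $y\in \mathbb{A}^{\mathbb{N}}$ and $y$ is recurrent. Let $D$ be a positive integer and assume that $M$ is a $D$-marker set for $y$. Then there exist languages $S,T\subseteq \mathbb{A}^*$ such that $\mathrm{Fac}(y)\subseteq ST$ and, for each $n\geq 2D$, both $p_S(n)$ and $p_T(n)$ are at most $$\sum_{k\in I_n\cap \mathbb{N}}p_M(2^k)\left(1+\frac{4p_y(3n)}{2^k}\right),$$ where $I_n$ is the half-open interval $\left(\log_2\left(\frac{n}{2D}\right), \log_2(2n)\right]$.
   Context: $\mathbb{A}^*$ is the set of finite words over $\mathbb{A}$, including the empty word $\varepsilon$; a language is a subset of $\mathbb{A}^*$; $ST=\{st : s\in S,\ t\in T\}$. For a language $L$, $p_L(n)$ is the number of words of length $n$ in $L$. For a finite, one-sided infinite or bi-infinite word $z$, $\mathrm{Fac}(z)$ is the set of all finite blocks of consecutive letters of $z$, together with $\varepsilon$; for infinite or bi-infinite $z$, $p_z(n)=p_{\mathrm{Fac}(z)}(n)$. A word $y\in\mathbb{A}^{\mathbb{N}}$ is recurrent if each prefix of $y$ occurs infinitely often in $y$. For a positive integer $D$, a subset $M\subseteq\mathbb{A}^*$ is a $D$-marker set for $y$ if for each $n\ge 1$ and each factor $u\in \mathrm{Fac}(y)$ of length $|u|\ge Dn$ we have $\mathrm{Fac}(u)\cap M\cap\mathbb{A}^n\ne\emptyset$. *)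

(* Defs.v *)
From mathcomp Require Import all_boot all_order all_algebra.
From mathcomp Require Import all_classical all_reals all_analysis.

Set Implicit Arguments.
Unset Strict Implicit.
Unset Printing Implicit Defensive.

Import Order.TTheory GRing.Theory Num.Theory.

Local Open Scope classical_set_scope.
Local Open Scope ring_scope.

Definition language (A : Type) := set (seq A).

Definition lang_cat (A : Type) (S T : language A) : language A :=
  [set s ++ t | s in S & t in T].

(* [complexity L n] is p_L(n). *)
Definition complexity (A : finType) (L : language A) (n : nat) : nat :=
  #|[pred w : n.-tuple A | `[< L w >]]|.

Inductive infinite_word (A : Type) : Type :=
| OneSided of (nat -> A)
| BiInfinite of (int -> A).

(* The block of length [n] starting at position [i]. *)
Definition nblock (A : Type) (y : nat -> A) (i n : nat) : seq A :=
  mkseq (fun j => y (i + j)%N) n.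

Definition zblock (A : Type) (y : int -> A) (i : int) (n : nat) : seq A :=
  mkseq (fun j : nat => y (i + j%:Z)) n.

(* The case n = 0 yields the empty word. *)
Definition Fac (A : Type) (y : infinite_word A) : language A :=
  match y with
  | OneSided x => [set w | exists i n, w = nblock x i n]
  | BiInfinite x => [set w | exists i n, w = zblock x i n]
  end.

Definition Fac_fin (A : eqType) (u : seq A) : language A :=
  [set w | infix w u].

Definition recurrent (A : Type) (y : nat -> A) : Prop :=
  forall n : nat, infinite_set [set i | nblock y i n = nblock y 0 n].

Definition marker_set (A : eqType) (D : nat) (y : infinite_word A)
    (M : language A) : Prop :=
  forall n : nat, (1 <= n)%N ->
  forall u : seq A, Fac y u -> (D * n <= size u)%N ->
  Fac_fin u `&` M `&` [set w | size w = n] !=set0.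

Definition log2 (R : realType) (x : R) : R := ln x / ln 2.

Definition marker_interval (R : realType) (D n : nat) : set R :=
  `]log2 (n%:R / (2 * D%:R)), log2 (2 * n%:R)]%classic.

(* Main.v *)
Require Import Defs.
From mathcomp Require Import all_boot all_order all_algebra.
From mathcomp Require Import all_classical all_reals all_analysis.
From mathcomp Require Import zify.

Set Implicit Arguments.
Unset Strict Implicit.
Unset Printing Implicit Defensive.

Import Order.TTheory GRing.Theory Num.Theory.

Local Open Scope classical_set_scope.
Local Open Scope nat_scope.

(** Every factor [w] of [y] with [2 * D <= size w] contains a marker [m] whose
    length [2 ^ k] is comparable to [size w], and [w] is cut in the middle of a
    suitably chosen occurrence of [m]. The left half of [m] then ends the first
    piece and the right half begins the second, so that it is enough to bound,
    for one marker [m] of length [2h] with [h <= n], the number of pieces of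
    length [n] coming from [m]: there should be at most [1 + 4 P / 2h] of them,
    where [P] is the number of factors of length [3n].

    A piece determines, together with the missing half of [m], a factor of
    length at most [2n] with [m] at a known place. This factor can be found at
    each of at least [n + 1] positions of factors of length [3n]. If the
    occurrences of [m] were always more than [h] apart, each word of length
    [3n] would be counted only a bounded number of times per [h] positions, and
    the bound would follow by double counting. Occurrences of [m] can be closer
    only inside a run, a stretch of period [p], the minimal period of [m].
    Hence the choice of the occurrence ([marker_cut]): it is the first one of
    its run, or the last one if the run goes back to the beginning of [w].
    If the letters around the cut still follow the period as far as the piece
    reaches, the piece is determined by [m], which gives the summand [1].
    Otherwise a break of the period touches one of the two ends of the
    occurrence; such occurrences are called landmarks. Two runs overlap in
    fewer than [p] letters and occurrences in the same run are at least [p]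
    apart, so three landmarks always spread over more than [2h] positions
    ([landmark_spread]). Thus a window of [2h + 1] positions contains at most
    two landmarks, which is exactly what the constant [4] requires
    ([complexity_landmark_words]).

    One difficulty remains for the right pieces: the break that makes the
    occurrence a landmark may lie to its left, outside of the piece. One then
    adds the [p] letters preceding the occurrence to the factor that is counted.
    This is needed only if the piece extends at least [p] letters beyond [m],
    and in this case the longer factor still has length at most [2n]
    ([context_size]). *)

(** * Periods of words and the places where they break *)

Definition period (A : eqType) (p : nat) (u : seq A) : bool :=
  prefix (drop p u) u.

Lemma periodP (A : eqType) (x0 : A) (p : nat) (u : seq A) :
  reflect (forall i, i + p < size u -> nth x0 u (i + p) = nth x0 u i)
          (period p u).
Proof.
rewrite /period prefixE; apply: (iffP eqP) => [e i lt_i|h].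
  rewrite addnC -nth_drop -e nth_take //.
  by rewrite size_drop ltn_subRL addnC.
have sz : size (take (size (drop p u)) u) = size (drop p u).
  by rewrite size_take_min size_drop; lia.
apply: (eq_from_nth (x0 := x0)) => // i; rewrite sz size_drop => lt_i.
rewrite nth_take ?size_drop // nth_drop addnC h //.
by move: lt_i; rewrite ltn_subRL addnC.
Qed.

Lemma has_period (A : eqType) (u : seq A) :
  exists p, (0 < p) && period p u.
Proof. by exists (size u).+1; rewrite /period drop_oversize ?prefix0s. Qed.

Definition min_period (A : eqType) (u : seq A) : nat := ex_minn (has_period u).

Lemma min_period_gt0 (A : eqType) (u : seq A) : 0 < min_period u.
Proof. by rewrite /min_period; case: ex_minnP => p /andP[]. Qed.

Lemma min_periodP (A : eqType) (u : seq A) : period (min_period u) u.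
Proof. by rewrite /min_period; case: ex_minnP => p /andP[]. Qed.

Lemma nth_min_period (A : eqType) (x0 : A) (u : seq A) (i : nat) :
  i + min_period u < size u -> nth x0 u (i + min_period u) = nth x0 u i.
Proof. by move: i; apply/periodP/min_periodP. Qed.

Lemma min_period_le (A : eqType) (u : seq A) (d : nat) :
  0 < d -> period d u -> min_period u <= d.
Proof.
move=> d0 pd; rewrite /min_period; case: ex_minnP => p _; apply.
by rewrite d0.
Qed.

Lemma min_period_le_size (A : eqType) (u : seq A) :
  0 < size u -> min_period u <= size u.
Proof. by move=> u0; apply: min_period_le; rewrite // /period drop_size prefix0s. Qed.

(** The boundary [b], before the letter of index [b], is straddled by two distinct
    letters at distance [p], so no stretch of period [p] crosses [b] with [p]
    letters on each side. *)
Definition break_at (A : eqType) (x0 : A) (p : nat) (v : seq A) (b : nat) :=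
  exists a, [/\ a < b, b <= a + p, a + p < size v
              & nth x0 v a <> nth x0 v (a + p)].

Lemma break_at_cat (A : eqType) (x0 : A) (p : nat) (e u f : seq A) (b : nat) :
  break_at x0 p u b -> break_at x0 p (e ++ u ++ f) (size e + b).
Proof.
case=> a [ab ba au neq]; exists (size e + a).
rewrite !size_cat !nth_cat.
have -> : (size e + a < size e) = false by lia.
have -> : (size e + a + p < size e) = false by lia.
have -> : size e + a - size e = a by lia.
have -> : size e + a + p - size e = a + p by lia.
have -> : a < size u by lia.
by rewrite au; split=> //; lia.
Qed.

Lemma break_at_drop (A : eqType) (x0 : A) (p k : nat) (v : seq A) (b : nat) :
  k + p <= b -> break_at x0 p v b -> break_at x0 p (drop k v) (b - k).
Proof.
move=> kb [a [ab ba av neq]]; exists (a - k).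
rewrite size_drop !nth_drop.
have -> : k + (a - k) = a by lia.
have -> : k + (a - k + p) = a + p by lia.
split=> //; lia.
Qed.

(** * Occurrences of a marker *)

Definition occurs (A : eqType) (m v : seq A) (i : nat) : Prop :=
  exists x z, v = x ++ m ++ z /\ size x = i.

Lemma occursP (A : eqType) (x0 : A) (m v : seq A) (i : nat) :
  i + size m <= size v ->
  (forall j, j < size m -> nth x0 v (i + j) = nth x0 m j) -> occurs m v i.
Proof.
move=> szv h; exists (take i v), (drop (i + size m) v).
have e : m = take (size m) (drop i v).
  have sz : size (take (size m) (drop i v)) = size m.
    by rewrite size_take_min size_drop; lia.
  apply: (eq_from_nth (x0 := x0)) => // j lj.
  by rewrite nth_take // nth_drop h.
split; last by rewrite size_take_min; lia.
rewrite -[LHS](cat_take_drop i v) -[drop i v](cat_take_drop (size m)) -e.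
by rewrite drop_drop [size m + i]addnC.
Qed.

Lemma occurs_nth (A : eqType) (x0 : A) (m v : seq A) (i j : nat) :
  occurs m v i -> j < size m -> nth x0 v (i + j) = nth x0 m j.
Proof.
case=> x [z [-> <-]] jm; rewrite !nth_cat.
have -> : (size x + j < size x) = false by lia.
have -> : size x + j - size x = j by lia.
by rewrite jm.
Qed.

Lemma occurs_cat (A : eqType) (m v e f : seq A) (i : nat) :
  occurs m v i -> occurs m (e ++ v ++ f) (size e + i).
Proof.
case=> x [z [-> <-]]; exists (e ++ x), (z ++ f).
by rewrite size_cat -!catA.
Qed.

(** The distance of two overlapping occurrences of [m] is a period of [m]; that of
    two disjoint ones is at least [size m], which is also a period. *)
Lemma occurs_gap (A : eqType) (m v : seq A) (i d : nat) :
  0 < size m -> 0 < d -> occurs m v i -> occurs m v (i + d) ->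
  min_period m <= d.
Proof.
move=> m0 d0 oi od.
case: (leqP d (size m)) => [dm|md]; last first.
  by apply: leq_trans (min_period_le_size m0) (ltnW md).
apply: min_period_le => //.
have [x0 _] : exists x0 : A, true by case: m m0 {oi od dm} => // a; exists a.
apply/(periodP x0) => j jd.
rewrite -(occurs_nth x0 oi jd) -(occurs_nth x0 od); last by lia.
by congr nth; lia.
Qed.

(** If the second occurrence came sooner, the two letters that break the period
    at the end of the first one would both lie in the second one, where the
    period holds. *)
Lemma break_right_gap (A : eqType) (x0 : A) (m v : seq A) (i d : nat) :
  0 < size m -> 0 < d -> occurs m v i -> occurs m v (i + d) ->
  break_at x0 (min_period m) v (i + size m) -> size m < d + min_period m.
Proof.
set p := min_period m => m0 d0 oi od [a [ab ba av neq]].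
have pd : p <= d := occurs_gap m0 d0 oi od.
rewrite ltnNge; apply/negP => dp; apply: neq.
have -> : a + p = i + d + (a - i - d + p) by lia.
have -> : nth x0 v a = nth x0 v (i + d + (a - i - d)) by congr nth; lia.
rewrite !(occurs_nth x0 od); try lia.
by symmetry; apply: nth_min_period; lia.
Qed.

(** The mirror image of [break_right_gap]: here the breaking letters would both
    lie in the first occurrence. *)
Lemma break_left_gap (A : eqType) (x0 : A) (m v : seq A) (i d : nat) :
  0 < size m -> 0 < d -> occurs m v i -> occurs m v (i + d) ->
  break_at x0 (min_period m) v (i + d) -> size m < d + min_period m.
Proof.
set p := min_period m => m0 d0 oi od [a [ab ba av neq]].
have pd : p <= d := occurs_gap m0 d0 oi od.
rewrite ltnNge; apply/negP => dp; apply: neq.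
have -> : a + p = i + (a - i + p) by lia.
have -> : nth x0 v a = nth x0 v (i + (a - i)) by congr nth; lia.
rewrite !(occurs_nth x0 oi); try lia.
by symmetry; apply: nth_min_period; lia.
Qed.

(** The first and the last occurrences of [m] in a run of period [min_period m],
    recognized by a break of the run within one period of an end of [m]. *)
Definition landmark (A : eqType) (x0 : A) (m v : seq A) (i : nat) : Prop :=
  occurs m v i /\ (break_at x0 (min_period m) v i \/
                   break_at x0 (min_period m) v (i + size m)).

Lemma landmark_cat (A : eqType) (x0 : A) (m v e f : seq A) (i : nat) :
  landmark x0 m v i -> landmark x0 m (e ++ v ++ f) (size e + i).
Proof.
case=> oi b; split; first exact: occurs_cat.
by case: b => b; [left|right; rewrite -addnA]; apply: break_at_cat.
Qed.

(** The break at the middle landmark [b] keeps the neighbour on that side more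
    than [size m - p] away, where [p] is the minimal period, and the other
    neighbour is at least [p] away. *)
Lemma landmark_spread (A : eqType) (x0 : A) (m v : seq A) (a b c : nat) :
  0 < size m -> a < b -> b < c ->
  landmark x0 m v a -> landmark x0 m v b -> landmark x0 m v c ->
  a + size m < c.
Proof.
move=> m0 ab bc [oa _] [ob brk] [oc _].
have eb : b = a + (b - a) by lia.
have ec : c = b + (c - b) by lia.
have dab : 0 < b - a by lia.
have dbc : 0 < c - b by lia.
have ob' : occurs m v (a + (b - a)) by rewrite -eb.
have oc' : occurs m v (b + (c - b)) by rewrite -ec.
have g1 := occurs_gap m0 dab oa ob'.
have g2 := occurs_gap m0 dbc ob oc'.
case: brk => brk.
  rewrite eb in brk; have := break_left_gap m0 dab oa ob' brk; lia.
have := break_right_gap m0 dbc ob oc' brk; lia.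
Qed.

(** * Cutting a word inside a marker *)

Definition factorial_language (A : eqType) (L : language A) : Prop :=
  forall u v, infix u v -> L v -> L u.

Definition extendable (A : eqType) (L : language A) : Prop :=
  forall u a b, L u ->
    exists c d, [/\ size c = a, size d = b & L (c ++ u ++ d)].

(** Without a break just before [m], the period extends [p] letters to the left
    of [m], or to the beginning of the word if that comes first; in the former
    case [m] occurs again, [p] positions earlier. *)
Lemma left_step (A : eqType) (x0 : A) (m x z : seq A) :
  let p := min_period m in
  [\/ break_at x0 p (x ++ m) (size x), period p (x ++ m)
    | exists x1 z1, x ++ m ++ z = x1 ++ m ++ z1 /\ size x1 < size x].
Proof.
move=> p; have p0 : 0 < p := min_period_gt0 m.
have ox : occurs m (x ++ m) (size x) by exists x, [::]; rewrite cats0.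
case: (pselect (break_at x0 p (x ++ m) (size x))) => [|nb]; first exact: Or31.
have eqb a : a < size x -> size x <= a + p -> a + p < size (x ++ m) ->
    nth x0 (x ++ m) a = nth x0 (x ++ m) (a + p).
  by move=> h1 h2 h3; apply: contrapT => h; apply: nb; exists a.
have pm := @nth_min_period _ x0 m; rewrite -/p in pm.
have inm a : size x <= a -> a + p < size (x ++ m) ->
    nth x0 (x ++ m) (a + p) = nth x0 (x ++ m) a.
  rewrite size_cat => h1 h2; rewrite (_ : a = size x + (a - size x)); last by lia.
  by rewrite -addnA !(occurs_nth x0 ox) ?pm //; lia.
case: (leqP p (size x)) => px; last first.
  apply: Or32; apply/(periodP x0) => i ip.
  by case: (ltnP i (size x)) => ix; [rewrite -eqb //; lia|exact: inm].
apply: Or33.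
have [x1 [z1 [e sx1]]] : occurs m (x ++ m) (size x - p).
  apply: (occursP (x0 := x0)); first by rewrite size_cat; lia.
  move=> j jm; rewrite -(occurs_nth x0 ox jm).
  case: (ltnP j p) => jp.
    by rewrite eqb ?size_cat; [congr nth|..]; lia.
  by rewrite -inm ?size_cat; [congr nth|..]; lia.
exists x1, (z1 ++ z); split; last by lia.
by rewrite catA e -!catA.
Qed.

(** The mirror image of [left_step]. The second occurrence overlaps the first or
    touches it, so a period coming from the left is carried along to its end. *)
Lemma right_step (A : eqType) (x0 : A) (m x z : seq A) :
  0 < size m -> let p := min_period m in
  [\/ break_at x0 p (m ++ z) (size m), period p (m ++ z)
    | exists c z1, [/\ m ++ z = c ++ m ++ z1, size c = p &
                       period p (x ++ m) -> period p (x ++ c ++ m)]].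
Proof.
move=> m0 p; have p0 : 0 < p := min_period_gt0 m.
have pm' : p <= size m := min_period_le_size m0.
have oz : occurs m (m ++ z) 0 by exists [::], z.
case: (pselect (break_at x0 p (m ++ z) (size m))) => [|nb]; first exact: Or31.
have eqb a : a < size m -> size m <= a + p -> a + p < size (m ++ z) ->
    nth x0 (m ++ z) a = nth x0 (m ++ z) (a + p).
  by move=> h1 h2 h3; apply: contrapT => h; apply: nb; exists a.
have pm := @nth_min_period _ x0 m; rewrite -/p in pm.
have inm a : a < size m -> a + p < size (m ++ z) ->
    nth x0 (m ++ z) (a + p) = nth x0 (m ++ z) a.
  move=> h1 h2; case: (ltnP (a + p) (size m)) => ap; last by rewrite -eqb.
  by rewrite -[a + p]add0n -[a in RHS]add0n !(occurs_nth x0 oz) ?pm.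
case: (leqP p (size z)) => pz; last first.
  by apply: Or32; apply/(periodP x0) => i ip; apply: inm; rewrite ?size_cat in ip *; lia.
apply: Or33.
have [c [z1 [e sc]]] : occurs m (m ++ z) p.
  apply: (occursP (x0 := x0)); first by rewrite size_cat; lia.
  move=> j jm; rewrite addnC inm // ?size_cat; last by lia.
  by rewrite -[j in LHS]add0n (occurs_nth x0 oz).
exists c, z1; split=> // /(periodP x0) pxm.
apply/(periodP x0) => i; rewrite !size_cat => ip.
case: (ltnP (i + p) (size (x ++ m))) => ixm.
  have pre j : j < size (x ++ m) -> nth x0 (x ++ c ++ m) j = nth x0 (x ++ m) j.
    move=> jxm; have : nth x0 ((x ++ c ++ m) ++ z1) j = nth x0 ((x ++ m) ++ z) j.
      by rewrite -!catA e.
    by rewrite !nth_cat jxm; case: ltnP => //; rewrite !size_cat in jxm *; lia.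
  by rewrite !pre //; [exact: pxm|lia].
have suf j : size x <= j -> j < size x + size c + size m ->
    nth x0 (x ++ c ++ m) j = nth x0 (m ++ z) (j - size x).
  move=> h1 h2; rewrite e !nth_cat.
  case: ltnP => [|_]; first by lia.
  case: ltnP => // _; case: ltnP => //; lia.
rewrite size_cat in ixm.
rewrite !suf; try lia.
rewrite (_ : i + p - size x = i - size x + p); last by lia.
by apply: inm; rewrite ?e ?size_cat; lia.
Qed.

(** The periodic pieces are determined by [m] and their length; the others are
    counted through the landmark words that contain them. *)
Definition left_piece (A : eqType) (x0 : A) (L : language A) (m : seq A) :
    language A :=
  [set s | exists x, s = x ++ take (size m)./2 m /\
     (period (min_period m) (x ++ m) \/
      L (x ++ m) /\ landmark x0 m (x ++ m) (size x))].

(** The number of letters to be kept before [m] when a piece has [r] letters after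
    [m]. For [r] smaller than the period, a break on the right of [m] is always
    visible in the piece unless it is periodic, and no left context is needed; for
    larger [r], the context is no longer than [r], so that the word to be
    counted is at most twice as long as the piece. *)
Definition context_size (A : eqType) (m : seq A) (r : nat) : nat :=
  if min_period m <= r then min_period m else 0.

Definition right_piece (A : eqType) (x0 : A) (L : language A) (m : seq A) :
    language A :=
  [set t | exists z, t = drop (size m)./2 m ++ z /\
     (period (min_period m) (m ++ z) \/
      exists c, [/\ size c = context_size m (size z), L (c ++ m ++ z)
                  & landmark x0 m (c ++ m ++ z) (size c)])].

(** Moving left in steps of the period, as long as [left_step] allows it, reaches
    the beginning of the run. *)
Lemma left_anchor (A : eqType) (x0 : A) (m w : seq A) :
  infix m w ->
  exists x z, w = x ++ m ++ z /\
    (break_at x0 (min_period m) (x ++ m) (size x) \/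
     period (min_period m) (x ++ m)).
Proof.
case/infixP=> x [z ->].
have [n] := ubnP (size x); elim: n x z => // n IHn x z sx.
case: (left_step x0 m x z) => [brk|per|[x1 [z1 [e sx1]]]].
- by exists x, z; split=> //; left.
- by exists x, z; split=> //; right.
- by rewrite e; apply: IHn; lia.
Qed.

(** Moving right in steps of the period reaches the end of the run; [right_step]
    keeps the part to the left periodic. *)
Lemma right_anchor (A : eqType) (x0 : A) (m x z : seq A) :
  0 < size m -> period (min_period m) (x ++ m) ->
  exists x1 z1, [/\ x ++ m ++ z = x1 ++ m ++ z1,
    period (min_period m) (x1 ++ m) &
    break_at x0 (min_period m) (m ++ z1) (size m) \/
    period (min_period m) (m ++ z1)].
Proof.
move=> m0; have [n] := ubnP (size z); elim: n x z => // n IHn x z sz pxm.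
case: (right_step x0 x z m0) => [brk|per|[c [z1 [e sc pc]]]].
- by exists x, z; split=> //; left.
- by exists x, z; split=> //; right.
have sz1 : size z1 < n.
  have := congr1 size e; rewrite !size_cat sc.
  by have := min_period_gt0 m; lia.
have [x2 [z2 [e2 p2 b2]]] := IHn (x ++ c) z1 sz1 (etrans (congr1 _ (esym (catA x c m))) (pc pxm)).
by exists x2, z2; split=> //; rewrite -e2 e !catA.
Qed.

Lemma right_pieceI (A : eqType) (x0 : A) (L : language A) (m x z : seq A) :
  factorial_language L -> extendable L -> 0 < size m -> L (x ++ m ++ z) ->
  [\/ break_at x0 (min_period m) (x ++ m ++ z) (size x),
      break_at x0 (min_period m) (x ++ m ++ z) (size x + size m)
    | period (min_period m) (m ++ z)] ->
  right_piece x0 L m (drop (size m)./2 m ++ z).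
Proof.
set p := min_period m => facL extL m0 Lw hyp; exists z; split=> //.
case: (boolP (period p (m ++ z))) => [per|nper]; [by left|right].
rewrite /context_size -/p; case: (leqP p (size z)) => pz; last first.
  exists [::]; split=> //.
    by apply: facL Lw; apply/infixP; exists x, [::]; rewrite cats0.
  split; first by exists [::], z.
  case: (right_step x0 x z m0) => [brk|per|[c [z1 [e sc _]]]].
  - by right.
  - by rewrite per in nper.
  - by move: (congr1 size e); rewrite !size_cat sc; rewrite -/p; lia.
(* The break may lie on the left of [m], so the [p] letters before [m] are kept;
   as [x] may be shorter than [p], the word is first extended to the left. *)
have [e [f [se _ Lef]]] := extL _ p 0 Lw.
have Le : L (e ++ x ++ m ++ z).
  by apply: facL Lef; apply/infixP; exists [::], f; rewrite /= -!catA.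
pose c := drop (size x) (e ++ x).
have sc : size c = p by rewrite size_drop size_cat se; lia.
have dw : drop (size x) (e ++ x ++ m ++ z) = c ++ m ++ z.
  by rewrite catA drop_cat; case: ltnP => //; rewrite size_cat se;
     have := min_period_gt0 m; rewrite -/p; lia.
exists c; split=> //.
  by apply: facL Le; rewrite -dw; apply: suffixW; apply: suffix_drop.
split; first by exists c, z.
have shift b : break_at x0 p (x ++ m ++ z) (size x + b) ->
    break_at x0 p (c ++ m ++ z) (size c + b).
  move=> /(@break_at_cat _ x0 p e _ [::]); rewrite cats0 se sc -dw => brk.
  have -> : p + b = p + (size x + b) - size x by lia.
  by apply: break_at_drop brk; lia.
case: hyp => [brk|brk|per].
- by left; have := shift 0; rewrite !addn0; apply.
- by right; apply: shift.
- by rewrite per in nper.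
Qed.

(** If the run of [m] begins inside [w], the cut is made in its first occurrence.
    Otherwise the part to the left is periodic wherever the run is cut, and the
    cut is made in its last occurrence, where a break may be seen on the right. *)
Lemma marker_cut (A : eqType) (x0 : A) (L : language A) (m w : seq A) :
  factorial_language L -> extendable L -> 0 < size m -> L w -> infix m w ->
  exists s t, [/\ w = s ++ t, left_piece x0 L m s & right_piece x0 L m t].
Proof.
move=> facL extL m0 Lw mw.
have cut x z : x ++ m ++ z = (x ++ take (size m)./2 m) ++ drop (size m)./2 m ++ z.
  by rewrite -catA (catA (take _ _)) cat_take_drop.
have [x [z [e]]] := left_anchor x0 mw.
case=> [brk|per]; rewrite e in Lw.
  have Lxm : L (x ++ m).
    by apply: facL Lw; apply/infixP; exists [::], z; rewrite /= -catA.
  exists (x ++ take (size m)./2 m), (drop (size m)./2 m ++ z).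
  split; first by rewrite e cut.
    exists x; split=> //; right; split=> //; split; last by left.
    by exists x, [::]; rewrite cats0.
  apply: (right_pieceI (x := x)) => //; apply: Or31.
  by have := @break_at_cat _ x0 _ [::] _ z _ brk; rewrite /= add0n -catA.
have [x1 [z1 [e1 per1 hyp]]] := right_anchor x0 z m0 per.
rewrite e1 in Lw.
exists (x1 ++ take (size m)./2 m), (drop (size m)./2 m ++ z1).
split; first by rewrite e e1 cut.
  by exists x1; split=> //; left.
apply: (right_pieceI (x := x1)) => //.
case: hyp => [brk|per2]; [apply: Or32|exact: Or33].
by have := @break_at_cat _ x0 _ x1 _ [::] _ brk; rewrite cats0.
Qed.

Lemma period_left_unique (A : eqType) (m x x' : seq A) :
  0 < size m -> size x = size x' ->
  period (min_period m) (x ++ m) -> period (min_period m) (x' ++ m) -> x = x'.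
Proof.
move=> m0; have pm := min_period_le_size m0; have p0 := min_period_gt0 m.
have [x0 _] : exists x0 : A, true by case: m m0 {pm p0} => // a; exists a.
move=> ss /(periodP x0) h /(periodP x0) h'.
have eqs n i : size x - i <= n -> i < size x + size m ->
    nth x0 (x ++ m) i = nth x0 (x' ++ m) i.
  elim: n i => [|n IHn] i si im.
    by rewrite !nth_cat -ss; case: ltnP => //; lia.
  case: (ltnP i (size x)) => ix; last by apply: (IHn i); lia.
  have ip : i + min_period m < size x + size m by lia.
  have [hi hi'] := (h i, h' i); rewrite !size_cat -ss in hi hi'.
  by rewrite -(hi ip) -(hi' ip); apply: IHn; lia.
apply: (eq_from_nth (x0 := x0)) => // i ix.
have := eqs (size x) i; rewrite !nth_cat -ss ix; apply; lia.
Qed.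

Lemma period_right_unique (A : eqType) (m z z' : seq A) :
  0 < size m -> size z = size z' ->
  period (min_period m) (m ++ z) -> period (min_period m) (m ++ z') -> z = z'.
Proof.
move=> m0; have pm := min_period_le_size m0; have p0 := min_period_gt0 m.
have [x0 _] : exists x0 : A, true by case: m m0 {pm p0} => // a; exists a.
move=> ss /(periodP x0) h /(periodP x0) h'.
have eqs n i : i <= n -> i < size m + size z ->
    nth x0 (m ++ z) i = nth x0 (m ++ z') i.
  elim: n i => [|n IHn] i si im; first by rewrite !nth_cat; case: ltnP => //; lia.
  case: (ltnP i (size m)) => ix; first by rewrite !nth_cat ix.
  have [hi hi'] := (h (i - min_period m), h' (i - min_period m)).
  rewrite !size_cat -ss subnK in hi hi'; last by lia.
  by rewrite (hi im) (hi' im); apply: IHn; lia.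
apply: (eq_from_nth (x0 := x0)) => // i ix.
have := eqs (size m + i) (size m + i); rewrite !nth_cat.
have -> : (size m + i < size m) = false by lia.
by rewrite addKn; apply; lia.
Qed.

(** * Counting words *)

(** Cardinalities are compared by inclusions between duplicate-free lists, which
    spares casts between tuples of different lengths. *)
Definition words_of (A : finType) (K : language A) (n : nat) : seq (seq A) :=
  [seq val w | w <- enum [pred w : n.-tuple A | `[< K w >]]].

Lemma size_words_of (A : finType) (K : language A) (n : nat) :
  size (words_of K n) = complexity K n.
Proof. by rewrite size_map -cardE. Qed.

Lemma words_of_uniq (A : finType) (K : language A) (n : nat) :
  uniq (words_of K n).
Proof. by rewrite map_inj_uniq ?enum_uniq //; apply: val_inj. Qed.

Lemma mem_words_of (A : finType) (K : language A) (n : nat) (w : seq A) :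
  reflect (size w = n /\ K w) (w \in words_of K n).
Proof.
apply: (iffP mapP) => [[t]|[sw Kw]].
  by rewrite mem_enum => + ->; rewrite unfold_in /= size_tuple => /asboolP.
have sw' : size w == n by apply/eqP.
by exists (Tuple sw') => //; rewrite mem_enum unfold_in /=; apply/asboolP.
Qed.

Lemma complexity_image (A : finType) (K U : language A) (n l : nat)
    (g : seq A -> seq A) :
  (forall s, size s = n -> K s -> exists u, [/\ size u = l, U u & s = g u]) ->
  complexity K n <= complexity U l.
Proof.
move=> h; rewrite -!size_words_of -(size_map g (words_of U l)).
apply: uniq_leq_size; first exact: words_of_uniq.
move=> s /mem_words_of[sn Ks]; have [u [su Uu ->]] := h s sn Ks.
by apply: map_f; apply/mem_words_of.
Qed.

Lemma complexity_le (A : finType) (K U : language A) (n : nat) :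
  (forall s, size s = n -> K s -> U s) -> complexity K n <= complexity U n.
Proof.
move=> h; apply: (complexity_image (g := id)) => s sn Ks.
by exists s; split=> //; apply: h.
Qed.

Lemma complexityU (A : finType) (K U : language A) (n : nat) :
  complexity [set s | K s \/ U s] n <= complexity K n + complexity U n.
Proof.
rewrite -!size_words_of -size_cat; apply: uniq_leq_size; first exact: words_of_uniq.
move=> s /mem_words_of[sn KUs]; rewrite mem_cat.
by apply/orP; case: KUs => h; [left|right]; apply/mem_words_of.
Qed.

Lemma complexity_le1 (A : finType) (K : language A) (n : nat) :
  (forall s t, size s = n -> size t = n -> K s -> K t -> s = t) ->
  complexity K n <= 1.
Proof.
move=> h; rewrite -size_words_of; move: (words_of_uniq K n) (@mem_words_of _ K n).
case: (words_of K n) => [|s [|t r]] //= + mem.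
rewrite inE negb_or => /andP[/andP[st _] _].
have /mem[ss Ks] : s \in [:: s, t & r] by rewrite inE eqxx.
have /mem[sst Kt] : t \in [:: s, t & r] by rewrite !inE eqxx orbT.
by rewrite (h s t) ?eqxx in st.
Qed.

Lemma complexity_bigcup (A : finType) (I : eqType) (r : seq I) (P : pred I)
    (K : I -> language A) (n : nat) :
  complexity [set s | exists i, [/\ i \in r, P i & K i s]] n
    <= \sum_(i <- r | P i) complexity (K i) n.
Proof.
elim: r => [|i r IHr].
  rewrite big_nil leqNgt -size_words_of -has_predT; apply/hasP.
  by case=> s /mem_words_of[_ [i []]].
rewrite big_cons; case: ifP => Pi; last first.
  apply: leq_trans IHr; apply: complexity_le => s _ [j [+ Pj Kj]].
  by rewrite inE => /orP[/eqP ej|jr]; [rewrite ej Pi in Pj|exists j].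
apply: leq_trans (leq_add (leqnn _) IHr); apply: leq_trans (complexityU _ _ _).
apply: complexity_le => s _ [j [+ Pj Kj]].
by rewrite inE => /orP[/eqP <-|jr]; [left|right; exists j].
Qed.

(** A window of [M + 1] consecutive positions contains at most two elements. *)
Lemma count_spread (P : pred nat) (M o N : nat) :
  (forall a b c, a < b -> b < c -> P a -> P b -> P c -> a + M < c) ->
  count P (iota o N) <= 2 * (N %/ M.+1).+1.
Proof.
move=> spread.
have window o' n : n <= M.+1 -> count P (iota o' n) <= 2.
  move=> nM; rewrite -size_filter.
  have : sorted ltn ([seq a <- iota o' n | P a]).
    by apply: sorted_filter; [apply: ltn_trans|apply: iota_ltn_sorted].
  have : all P ([seq a <- iota o' n | P a]) by rewrite filter_all.
  have : {subset [seq a <- iota o' n | P a] <= iota o' n}.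
    by move=> x; rewrite mem_filter => /andP[].
  case: [seq a <- iota o' n | P a] => [|a [|b [|c s]]] //= sub.
  move=> /and4P[Pa Pb Pc _] /and3P[ab bc _].
  have := sub a; have := sub c; rewrite !inE !eqxx !orbT !mem_iota.
  move=> /(_ isT) hc /(_ isT) ha.
  by have := spread a b c ab bc Pa Pb Pc; lia.
have [n] := ubnP N; elim: n N o => // n IHn N o lN.
case: (leqP N M.+1) => NM.
  by apply: leq_trans (window _ _ NM) _; rewrite leq_pmulr.
have -> : iota o N = iota o M.+1 ++ iota (o + M.+1) (N - M.+1).
  by rewrite -iotaD; congr iota; lia.
rewrite count_cat.
have -> : N %/ M.+1 = ((N - M.+1) %/ M.+1).+1.
  by rewrite -{1}(subnK (ltnW NM)) -{2}[M.+1]mul1n divnDMl // addn1.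
by have := window o M.+1 (leqnn _); have := IHn (N - M.+1) (o + M.+1); lia.
Qed.

Definition landmark_words (A : eqType) (x0 : A) (L : language A) (m : seq A)
    (i : nat) : language A :=
  [set u | L u /\ landmark x0 m u i].

(** Double counting of the pairs formed by a word [v] of length [n] in [L] and one
    of the [N = n - l + 1] positions in [v]. Each landmark word occurs at every
    position of some [v], as [L] is extendable; conversely [v] has at most
    [2 * (N %/ (size m + 1) + 1)] positions that are landmarks, and this is at
    most [4 * N / size m] as soon as [size m <= 2 * N]. *)
Lemma complexity_landmark_words (A : finType) (x0 : A) (L : language A)
    (m : seq A) (i l n : nat) :
  extendable L -> 0 < size m -> l <= n -> size m <= 2 * (n - l).+1 ->
  complexity (landmark_words x0 L m i) l * size m <= 4 * complexity L n.
Proof.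
move=> extL m0 ln mN.
set X := complexity _ l; set P := complexity L n; have [N defN] : exists N, N = (n - l).+1 by exists (n - l).+1.
rewrite -defN in mN.
pose here v : pred nat := fun a => `[< landmark x0 m v (a + i) >].
set Q := 2 * (N %/ (size m).+1).+1.
have cnt v : count (here v) (iota 0 N) <= Q.
  apply: count_spread => a b c ab bc /asboolP ha /asboolP hb /asboolP hc.
  have := landmark_spread m0 _ _ ha hb hc; rewrite !ltn_add2r => /(_ ab bc).
  by rewrite addnAC ltn_add2r.
have XN : X * N <= P * Q.
  (* Reading the word of length [l] at position [a] of [v] recovers the landmark
     word, so the second list covers the first. *)
pose s1 := [seq (u, a) | u <- words_of (landmark_words x0 L m i) l, a <- iota 0 N].
  pose s2 := [seq (take l (drop a v), a) | v <- words_of L n,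
                                   a <- [seq a <- iota 0 N | here v a]].
  have -> : X * N = size s1 by rewrite size_allpairs size_words_of size_iota.
  have le2 : size s2 <= P * Q.
    rewrite size_allpairs_dep sumnE big_map.
    apply: (@leq_trans (\sum_(v <- words_of L n) Q)).
      by apply: leq_sum => v _; rewrite size_filter.
    by rewrite big_const_seq count_predT iter_addn_0 size_words_of mulnC.
  apply: leq_trans le2; apply: uniq_leq_size.
    by apply: allpairs_uniq; rewrite ?words_of_uniq ?iota_uniq // => -[? ?] [? ?].
  move=> _ /allpairsP[[u a] /= [/mem_words_of[su [Lu lu]] aN ->]].
  rewrite mem_iota /= add0n in aN.
  have [c [d [sc sd Lv]]] := extL u a (n - l - a) Lu.
  apply/allpairsPdep; exists (c ++ u ++ d), a; split.
  - by apply/mem_words_of; rewrite !size_cat sc sd su; split=> //; lia.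
  - rewrite mem_filter mem_iota /= add0n aN andbT; apply/asboolP.
    by rewrite -sc; apply: landmark_cat.
  - by rewrite drop_size_cat // take_size_cat.
have Qm : Q * size m <= 4 * N.
  rewrite /Q; have := leq_divM N (size m).+1.
  case: (N %/ (size m).+1) => [|q] h; first by lia.
  nia.
have : X * size m * N <= 4 * P * N.
  rewrite mulnAC; apply: leq_trans (leq_mul XN (leqnn _)) _.
  by rewrite -mulnA; apply: leq_trans (leq_mul (leqnn _) Qm) _; lia.
by rewrite leq_pmul2r // defN.
Qed.

(** One periodic piece, and the landmark words of length [n + h], where [2h] is
    the length of [m]; as [h <= n], they leave at least [n + 1] free positions in
    a word of length [3 n]. *)
Lemma complexity_left_piece (A : finType) (x0 : A) (L : language A)
    (m : seq A) (n : nat) :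
  extendable L -> 0 < size m -> ~~ odd (size m) -> (size m)./2 <= n ->
  (complexity (left_piece x0 L m) n - 1) * size m <= 4 * complexity L (3 * n).
Proof.
move=> extL m0 ev hn; set h := (size m)./2 in hn *.
have sm : size m = h + h by rewrite addnn /h -{1}[size m]odd_double_half (negbTE ev).
pose per := [set s | exists x, s = x ++ take h m /\ period (min_period m) (x ++ m)].
have sth : size (take h m) = h by rewrite size_take_min sm; lia.
have per1 : complexity per n <= 1.
  apply: complexity_le1 => s s' + + [x [es px]] [x' [es' px']].
  rewrite {}es {}es'.
  rewrite !size_cat sth => sx sx'.
  by rewrite (period_left_unique m0 _ px px') //; apply: (@addIn h); rewrite sx sx'.
have le : complexity (left_piece x0 L m) n <=
    1 + complexity (landmark_words x0 L m (n - h)) (n + h).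
  apply: leq_trans (leq_add per1 (leqnn _)).
  apply: (leq_trans (complexity_le (U := [set s | per s \/
    exists u, [/\ size u = n + h, landmark_words x0 L m (n - h) u & s = take n u]]) _)).
    move=> s ss [x [es [px|[Lx lx]]]]; first by left; exists x.
    right; exists (x ++ m); rewrite es size_cat sth in ss.
    split; first by rewrite size_cat sm addnA ss.
      by split=> //; rewrite -ss addnK.
    rewrite es take_cat -ss addKn; case: ltnP => //.
    by rewrite ltnNge leq_addr.
  apply: leq_trans (complexityU _ _ _) _; rewrite leq_add2l.
  by apply: (complexity_image (g := take n)) => s _ [u hu]; exists u.
apply: leq_trans (complexity_landmark_words x0 (n - h) (l := n + h) extL m0 _ _); try lia.
by rewrite leq_mul2r leq_subLR le orbT.
Qed.

Lemma complexity_right_piece (A : finType) (x0 : A) (L : language A)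
    (m : seq A) (n : nat) :
  extendable L -> 0 < size m -> ~~ odd (size m) -> (size m)./2 <= n ->
  (complexity (right_piece x0 L m) n - 1) * size m <= 4 * complexity L (3 * n).
Proof.
move=> extL m0 ev hn; set h := (size m)./2 in hn *.
have sm : size m = h + h by rewrite addnn /h -{1}[size m]odd_double_half (negbTE ev).
pose per := [set t | exists z, t = drop h m ++ z /\ period (min_period m) (m ++ z)].
have hm : h < size m by lia.
have sdh : size (drop h m) = h by rewrite size_drop sm; lia.
have per1 : complexity per n <= 1.
  apply: complexity_le1 => t t' + + [z [et pz]] [z' [et' pz']].
  rewrite {}et {}et'.
  rewrite !size_cat sdh => sz sz'.
  by rewrite (period_right_unique m0 _ pz pz') //; apply: (@addnI h); rewrite sz sz'.
set q := context_size m (n - h).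
have qn : q <= n - h by rewrite /q /context_size; case: ifP.
have le : complexity (right_piece x0 L m) n <=
    1 + complexity (landmark_words x0 L m q) (q + (n + h)).
  apply: leq_trans (leq_add per1 (leqnn _)).
  apply: (leq_trans (complexity_le (U := [set s | per s \/
    exists u, [/\ size u = q + (n + h), landmark_words x0 L m q u & s = drop (q + h) u]]) _)).
    move=> t st [z [et [pz|[c [sc Lc lc]]]]]; first by left; exists z.
    rewrite et size_cat sdh in st.
    have sz : size z = n - h by rewrite -st addKn.
    rewrite sz -/q in sc.
    right; exists (c ++ m ++ z); split.
    - by rewrite !size_cat sc sm sz -addnA subnKC // addnC [h + n]addnC addnC.
    - by split=> //; rewrite -sc.
    rewrite et addnC -drop_drop drop_size_cat // drop_cat.
    by rewrite hm.
  apply: leq_trans (complexityU _ _ _) _; rewrite leq_add2l.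
  by apply: (complexity_image (g := drop (q + h))) => s _ [u hu]; exists u.
apply: leq_trans (complexity_landmark_words x0 q (l := q + (n + h)) extL m0 _ _); try lia.
by rewrite leq_mul2r leq_subLR le orbT.
Qed.

(** * Factors of infinite words *)

Lemma mkseq_cat (T : Type) (f : nat -> T) (a b : nat) :
  mkseq f (a + b) = mkseq f a ++ mkseq (fun j => f (a + j)) b.
Proof.
rewrite /mkseq iotaD map_cat add0n; congr (_ ++ _).
by rewrite -[X in iota X]addn0 iotaDl -map_comp.
Qed.

Lemma infix_mkseq (A : eqType) (f : nat -> A) (u : seq A) (n : nat) :
  infix u (mkseq f n) -> exists a, u = mkseq (fun j => f (a + j)) (size u).
Proof.
case/infixP=> c [d e]; exists (size c).
have en : n = size c + (size u + size d).
  by rewrite -(size_mkseq f n) e !size_cat.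
move: e; rewrite {n}en !mkseq_cat => /eqP.
rewrite eqseq_cat ?size_mkseq // => /andP[_].
by rewrite eqseq_cat ?size_mkseq // => /andP[/eqP].
Qed.

Lemma Fac_factorial (A : eqType) (y : infinite_word A) :
  factorial_language (Fac y).
Proof.
case: y => y u v uv [i [n ev]]; rewrite {}ev in uv.
  have [a ->] := infix_mkseq uv; exists (i + a), (size u).
  by apply: eq_mkseq => j; rewrite addnA.
have [a ->] := infix_mkseq uv; exists (i + a%:Z)%R, (size u).
by apply: eq_mkseq => j; rewrite PoszD addrA.
Qed.

Lemma Fac_extendable_bi (A : eqType) (y : int -> A) :
  extendable (Fac (BiInfinite y)).
Proof.
move=> _ a b [i [n ->]].
exists (zblock y (i - a%:Z)%R a), (zblock y (i + n%:Z)%R b).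
rewrite !size_mkseq; split=> //; exists (i - a%:Z)%R, (a + (n + b)).
rewrite /zblock !mkseq_cat; congr (_ ++ (_ ++ _)); apply: eq_mkseq => j; congr y;
  lia.
Qed.

(** A factor of the prefix of length [i + n] occurs again wherever the prefix does,
    hence arbitrarily far from the origin, with room on its left. *)
Lemma Fac_extendable_recurrent (A : eqType) (y : nat -> A) :
  recurrent y -> extendable (Fac (OneSided y)).
Proof.
move=> rec _ a b [i [n ->]].
have [i' [ai' ei']] : exists i', a <= i' /\ nblock y i n = nblock y i' n.
  apply: contrapT => none; apply: (rec (i + n)).
  apply: (sub_finite_set (B := `I_a)); last exact: finite_II.
  move=> j /= e; rewrite ltnNge; apply/negP => aj; apply: none.
  exists (j + i); split; first by rewrite (leq_trans aj) ?leq_addr.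
  move: e; rewrite /nblock !mkseq_cat => /eqP; rewrite eqseq_cat ?size_mkseq //.
  case/andP=> _ /eqP e; rewrite -[LHS]e.
  by apply: eq_mkseq => k; rewrite addnA.
exists (nblock y (i' - a) a), (nblock y (i' + n) b).
rewrite !size_mkseq; split=> //; exists (i' - a), (a + (n + b)).
rewrite ei' /nblock !mkseq_cat; congr (_ ++ (_ ++ _)); apply: eq_mkseq => j; congr y;
  lia.
Qed.

(** * Summing over the marker lengths *)

Lemma marker_intervalE (R : realType) (D n k : nat) :
  0 < D -> 0 < n ->
  marker_interval D n (k%:R : R)%R <-> (n < 2 * D * 2 ^ k) && (2 ^ k <= 2 * n).
Proof.
move=> D0 n0; rewrite /marker_interval /= in_itv /= /log2.
have ln2 : (0 < ln 2 :> R)%R by apply: ln_gt0; rewrite ltr1n.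
have n0' : (0 < n%:R :> R)%R by rewrite ltr0n.
have D0' : (0 < 2 * D%:R :> R)%R by rewrite mulr_gt0 // ltr0n.
have lnk : (k%:R * ln 2 = ln (2 ^+ k) :> R)%R by rewrite lnXn // mulr_natl.
rewrite ltr_pdivrMr // ler_pdivlMr // lnk.
rewrite ltr_ln ?posrE ?divr_gt0 ?exprn_gt0 // ler_ln ?posrE ?mulr_gt0 ?exprn_gt0 //.
rewrite ltr_pdivrMr // -natrX -!natrM ltr_nat ler_nat.
by rewrite [2 ^ k * _]mulnC.
Qed.

(** Union bound over all markers of the lengths allowed by [n]; the exponents [k]
    range over a finite list since [k < 2 ^ k <= 2 * n]. *)
Lemma complexity_pieces (R : realType) (A : finType) (M K : language A)
    (piece : seq A -> language A) (D P n : nat) :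
  0 < D -> 2 * D <= n ->
  (forall s, size s = n -> K s -> exists k m,
     [/\ M m, size m = 2 ^ k, n < 2 * D * 2 ^ k, 2 ^ k <= 2 * n & piece m s]) ->
  (forall k m, size m = 2 ^ k -> n < 2 * D * 2 ^ k -> 2 ^ k <= 2 * n ->
     (complexity (piece m) n - 1) * 2 ^ k <= 4 * P) ->
  ((complexity K n)%:R <=
   \sum_(k \in [set k : nat | marker_interval D n (k%:R : R)%R])
     ((complexity M (2 ^ k)%N)%:R * (1 + 4 * P%:R / (2 : R) ^+ k)))%R.
Proof.
move=> D0 Dn KM bnd; have n0 : 0 < n by lia.
pose good k := (n < 2 * D * 2 ^ k) && (2 ^ k <= 2 * n).
pose r := [seq k <- iota 0 (2 * n).+1 | good k].
have -> : [set k : nat | marker_interval D n (k%:R : R)%R] = [set` r].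
  apply/seteqP; split=> k /=; rewrite mem_filter mem_iota /= add0n.
    move/(marker_intervalE R k D0 n0) => gk; rewrite /good gk /= ltnS.
    by case/andP: gk => _; apply: leq_trans; rewrite ltnW // ltn_expl.
  by case/andP=> gk _; apply/(marker_intervalE R k D0 n0).
rewrite -fsbig_seq ?filter_uniq ?iota_uniq //.
have le : complexity K n <=
    \sum_(k <- r) \sum_(m <- words_of M (2 ^ k)) complexity (piece m) n.
  have := complexity_bigcup r predT (fun k => [set s | exists m,
    [/\ m \in words_of M (2 ^ k), true & piece m s]]) n.
  move=> /(leq_trans _); move=> /(_ (complexity K n)) h.
  apply: leq_trans (h _) _.
    apply: complexity_le => s sn /(KM s sn)[k [m [Mm sm lk uk pms]]].
    exists k; split=> //.
      rewrite mem_filter /good lk uk mem_iota /= add0n ltnS.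
      by apply: leq_trans uk; rewrite ltnW // ltn_expl.
    by exists m; split=> //; apply/mem_words_of.
  by apply: leq_sum => k _; apply: complexity_bigcup.
move: le; rewrite -(ler_nat R) => /le_trans; apply.
rewrite natr_sum big_seq [leRHS]big_seq; apply: ler_sum => k.
rewrite mem_filter => /andP[/andP[lk uk] _]; rewrite natr_sum.
have -> : ((complexity M (2 ^ k)%N)%:R * (1 + 4 * P%:R / (2 : R) ^+ k) =
    \sum_(m <- words_of M (2 ^ k)) (1 + 4 * P%:R / (2 : R) ^+ k))%R.
  by rewrite big_const_seq count_predT size_words_of iter_addr_0 mulr_natl.
rewrite big_seq [leRHS]big_seq; apply: ler_sum => m /mem_words_of[sm _].
have := bnd k m sm lk uk; rewrite -(ler_nat R) !natrM natrX.
have p2 : (0 < 2 ^+ k :> R)%R by rewrite exprn_gt0.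
rewrite -ler_pdivlMr // => h; rewrite addrC -lerBlDr; apply: le_trans h.
case: (complexity (piece m) n) => [|c]; first by rewrite sub0r lerN10.
by rewrite subn1 /= -natr1 addrK.
Qed.

(** The scale at which every factor of length [l] contains a marker of length
    [2 ^ k]; for [l >= 2 * D] this marker has an exact middle. *)
Lemma dyadic_scale (D l : nat) :
  0 < D -> 2 * D <= l ->
  exists k, [/\ 0 < k, D * 2 ^ k <= l & l < 2 * D * 2 ^ k].
Proof.
move=> D0 Dl; have q1 : 1 < l %/ D by rewrite leq_divRL.
exists (trunc_log 2 (l %/ D)).
have lo := trunc_logP (isT : 1 < 2) (ltnW q1).
have hi := trunc_log_ltn (l %/ D) (isT : 1 < 2).
split; first by rewrite trunc_log_gt0 q1.
  by rewrite mulnC -leq_divRL.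
by rewrite ltn_divLR // expnS in hi; rewrite mulnAC.
Qed.

(** * The two languages *)

Local Open Scope ring_scope.

Theorem theorem4p4 (R : realType) (A : finType) (A_gt0 : (0 < #|A|)%N)
    (y : infinite_word A)
    (hy : (exists z : int -> A, y = BiInfinite z) \/
          (exists x : nat -> A, y = OneSided x /\ recurrent x))
    (D : nat) (D_gt0 : (0 < D)%N)
    (M : language A) (hM : marker_set D y M) :
  exists S T : language A,
    Fac y `<=` lang_cat S T /\
    forall n : nat, (2 * D <= n)%N ->
      let bound : R :=
        \sum_(k \in [set k : nat | marker_interval D n (k%:R : R)])
          ((complexity M (2 ^ k)%N)%:R *
           (1 + 4 * (complexity (Fac y) (3 * n)%N)%:R / (2 : R) ^+ k)) in
      (complexity S n)%:R <= bound /\ (complexity T n)%:R <= bound.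
Proof.
have [x0 _] : exists x0 : A, true by move/card_gt0P: A_gt0 => [a _]; exists a.
have facL : factorial_language (Fac y) by apply: Fac_factorial.
have extL : extendable (Fac y).
  case: hy => [[z ->]|[x [-> rec]]]; first exact: Fac_extendable_bi.
  exact: Fac_extendable_recurrent.
pose pieces (piece : seq A -> language A) : language A :=
  [set s | exists k m, [/\ M m, size m = (2 ^ k)%N, (0 < k)%N,
                           (size s < 2 * D * 2 ^ k)%N & piece m s]].
have half k (m : seq A) : (0 < k)%N -> size m = (2 ^ k)%N ->
    size m = ((size m)./2 * 2)%N.
  by case: k => // k _ ->; rewrite expnS mul2n doubleK muln2.
(* Short factors are put whole into [S]: lengths below [2 * D] are not counted. *)
exists [set s | (size s < 2 * D)%N \/ pieces (left_piece x0 (Fac y)) s].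
exists [set t | t = [::] \/ pieces (right_piece x0 (Fac y)) t].
split.
  move=> w Lw; case: (ltnP (size w) (2 * D)) => [short|long].
    by exists w; [left|exists [::]; [left|rewrite cats0]].
  have [k [k0 lk uk]] := dyadic_scale D_gt0 long.
  have [m [[mw Mm] sm]] := hM (2 ^ k)%N (expn_gt0 2 k) w Lw lk.
  have m0 : (0 < size m)%N by rewrite sm expn_gt0.
  have [s [t [ew ls rt]]] := marker_cut x0 facL extL m0 Lw mw.
  have sw : size w = (size s + size t)%N by rewrite ew size_cat.
  exists s; last (exists t; last by rewrite ew).
    by right; exists k, m; split=> //; apply: leq_ltn_trans uk; rewrite sw leq_addr.
  by right; exists k, m; split=> //; apply: leq_ltn_trans uk; rewrite sw leq_addl.
move=> n Dn /=; have n0 : (0 < n)%N by lia.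
have even_marker k (m : seq A) : size m = (2 ^ k)%N -> (n < 2 * D * 2 ^ k)%N ->
    (2 ^ k <= 2 * n)%N ->
    [/\ (0 < size m)%N, ~~ odd (size m) & ((size m)./2 <= n)%N].
  move=> sm lk uk; have k0 : (0 < k)%N by case: k lk {sm uk} => //; lia.
  split; first by rewrite sm expn_gt0.
    by rewrite sm oddX negb_or -lt0n k0.
  by have := half k m k0 sm; lia.
split;
  [apply: (complexity_pieces R (piece := left_piece x0 (Fac y)) D_gt0 Dn)
  |apply: (complexity_pieces R (piece := right_piece x0 (Fac y)) D_gt0 Dn)].
- move=> s sn [short|[k [m [Mm sm k0 lk pms]]]]; first by lia.
  exists k, m; rewrite -sn; split=> //; case: pms => x [-> _].
  rewrite -sm {1}(half k m k0 sm) mulnC leq_mul2l /= size_cat size_take_min.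
  by have := half k m k0 sm; lia.
- move=> k m sm lk uk; have [m0 ev hn] := even_marker k m sm lk uk.
  by rewrite -sm; apply: complexity_left_piece.
- move=> t tn [t0|[k [m [Mm sm k0 lk pmt]]]]; first by rewrite t0 /= in tn; lia.
  exists k, m; rewrite -tn; split=> //; case: pmt => z [-> _].
  rewrite -sm {1}(half k m k0 sm) mulnC leq_mul2l /= size_cat size_drop.
  by have := half k m k0 sm; lia.
- move=> k m sm lk uk; have [m0 ev hn] := even_marker k m sm lk uk.
  by rewrite -sm; apply: complexity_right_piece.
Qed.
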